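(* Let $p\in(0,1)$ and let $c>0$. For every connected, regular graph $G$ with $n$ vertices, the mixing time of the edge flipping on $G$ with parameter $p$ satisfies $$\frac14\, n\log n-\mathcal{O}(n)\;\le\; t_{\mathrm{mix}}(e^{-c})\;\le\;\frac12\, n\log n+\mathcal{O}(n),$$ that is, there is a constant $C$ depending only on $p$ and $c$ (not on $n$, on $G$, or on the degree of its vertices) such that $\frac14 n\log n-Cn\le t_{\mathrm{mix}}(e^{-c})\le\frac12 n\log n+Cn$ for every such $G$.
   Context: A graph is regular if all its vertices have the same degree. Edge flipping: let $G$ be a finite connected graph with at least one edge, with vertex set $V(G)$, and let $p\in(0,1)$, $q=1-p$. The edge flipping on $G$ with parameter $p$ is the discrete-time Markov chain on the set $\Omega=\{\text{blue},\text{red}\}^{V(G)}$ of vertex colorings in which, at each step, an edge of $G$ is chosen uniformly at random (independently of the past) and then, independently, both of its endpoints are (re)colored blue with probability $p$, or both are (re)colored red with probability $q$. It has a unique stationary distribution $\pi$. Total variation distance: $\|\mu-\nu\|_{TV}=\frac12\sum_{x\in\Omega}|\mu(x)-\nu(x)|$. With $P^t_z$ the law of the chain after $t$ steps started from $z\in\Omega$, put $d_{TV}(t)=\max_{z\in\Omega}\|P^t_z-\pi\|_{TV}$. The mixing time is $t_{\mathrm{mix}}(\epsilon)=\min\{t: d_{TV}(t)\le\epsilon\}$. Here $\log$ is the natural logarithm. *)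

(* Defs.v *)
From HB Require Import structures.
From mathcomp Require Import all_boot all_order all_algebra.
From mathcomp Require Import all_classical all_reals all_analysis.

Set Implicit Arguments.
Unset Strict Implicit.
Unset Printing Implicit Defensive.

Import Order.TTheory GRing.Theory Num.Theory.
Local Open Scope ring_scope.

Section Graphs.
Variables (V : finType) (e : rel V).

Definition simple_graph : Prop := symmetric e /\ irreflexive e.

Definition connected_graph : Prop := forall x y : V, connect e x y.

Definition degree (x : V) : nat := #|[set y | e x y]|.

Definition regular_graph : Prop := forall x y : V, degree x = degree y.

(* An edge is the unordered pair of its endpoints. *)
Definition edges : {set {set V}} :=
  [set [set u.1; u.2] | u in [set u : V * V | e u.1 u.2]].

End Graphs.

Section MarkovChains.
Variables (R : realType) (S : finType).
Implicit Types (P : S -> S -> R) (mu nu : S -> R).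

Definition is_distribution mu : Prop :=
  (forall x, 0 <= mu x) /\ \sum_x mu x = 1.

Definition next_law P mu : S -> R := fun y => \sum_x mu x * P x y.

Definition is_stationary P mu : Prop :=
  is_distribution mu /\ forall y, next_law P mu y = mu y.

Definition law_after P (t : nat) (z : S) : S -> R :=
  iter t (next_law P) (fun x => (x == z)%:R).

Definition tv_dist mu nu : R := 2^-1 * \sum_x `|mu x - nu x|.

(* Total variation distances are nonnegative, so 0 is a neutral default. *)
Definition d_TV P mu (t : nat) : R :=
  \big[Num.max/0]_(z : S) tv_dist (law_after P t z) mu.

(* [t] is the least time at which [d_TV] is at most [eps]; in particular such
   a time exists. *)
Definition is_mixing_time P mu (eps : R) (t : nat) : Prop :=
  d_TV P mu t <= eps /\ forall s : nat, d_TV P mu s <= eps -> (t <= s)%N.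

End MarkovChains.

Section EdgeFlipping.
Variables (R : realType) (V : finType) (e : rel V) (p : R).

(* [true] is blue, [false] is red. *)
Definition coloring : finType := {ffun V -> bool}.

Definition recolor (x : coloring) (A : {set V}) (b : bool) : coloring :=
  [ffun v => if v \in A then b else x v].

Definition edge_flipping (x y : coloring) : R :=
  (#|edges e|%:R)^-1 *
  \sum_(A in edges e) (p * (y == recolor x A true)%:R
                       + (1 - p) * (y == recolor x A false)%:R).

End EdgeFlipping.

(* Main.v *)
Require Import Defs.
From mathcomp Require Import all_boot all_order all_algebra.
From mathcomp Require Import all_classical all_reals all_analysis.
From mathcomp Require Import ring lra.

Set Implicit Arguments.
Unset Strict Implicit.
Unset Printing Implicit Defensive.

Import Order.TTheory GRing.Theory Num.Theory.
Local Open Scope ring_scope.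

(** Write n for the number of vertices, m for the number of edges and D for the
    common degree.  Every vertex lies on D edges and n D = 2 m, so a given
    vertex is missed by the edge drawn at one step with probability
    k = 1 - 2/n, whatever the degree.  Both bounds come from this number.

    Upper bound.  Run two copies of the chain with the same edges and colors:
    they can differ only at vertices missed so far, so their expected Hamming
    distance is multiplied by k at each step.  Dually, averaging a function
    over one step multiplies its Lipschitz constant by k
    ([edge_flipping_contraction]).  Since the distance is at most n, the total
    variation distance at time t is at most n k^t
    ([d_TV_edge_flipping_le]), which is at most exp(-c) as soon as
    t >= n (ln n + c) / 2.

    Lower bound.  A vertex that is recolored becomes blue with probability p,
    so f(x) = sum over v of (1[x_v blue] - p) is an eigenfunction of the chain
    with eigenvalue k ([averaging_blue_excess]).  From the all-blue coloring
    its mean at time t is k^t n (1 - p), while its stationary mean is 0.  One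
    step changes f by at most 2, which keeps its variance at most n at all times
    and at stationarity.  Chebyshev's inequality then separates the two laws by
    the event that f is at least half its mean (Wilson's method, [d_TV_eigen]),
    so a total variation distance of at most exp(-c) forces n k^(2t) to be
    bounded in terms of p and c.  Taking logarithms, t is at least
    n ln n / 4 - O(n). *)

(** * Expectations and total variation on a finite chain *)

Section FiniteChains.
Variables (R : realType) (S : finType).
Implicit Types (P : S -> S -> R) (mu nu f : S -> R).

Definition expectation mu f : R := \sum_x mu x * f x.

Definition averaging P f : S -> R := fun x => \sum_y P x y * f y.

Definition is_transition P : Prop := forall x, is_distribution (P x).

Lemma expectation_next_law P mu f :
  expectation (next_law P mu) f = expectation mu (averaging P f).
Proof.
rewrite /expectation /next_law /averaging.
under eq_bigr do rewrite mulr_suml.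
rewrite exchange_big /=; apply: eq_bigr => x _.
by rewrite mulr_sumr; apply: eq_bigr => y _; rewrite mulrA.
Qed.

Lemma ler_expectation mu f g :
  is_distribution mu -> (forall x, f x <= g x) ->
  expectation mu f <= expectation mu g.
Proof. by move=> [mu0 _] fg; apply: ler_sum => x _; exact: ler_wpM2l. Qed.

Lemma expectationD mu f g :
  expectation mu (fun x => f x + g x) = expectation mu f + expectation mu g.
Proof. by rewrite -big_split; apply: eq_bigr => x _; rewrite mulrDr. Qed.

Lemma expectationZ mu k f :
  expectation mu (fun x => k * f x) = k * expectation mu f.
Proof. by rewrite mulr_sumr; apply: eq_bigr => x _; rewrite mulrCA. Qed.

Lemma expectation_cst mu k :
  is_distribution mu -> expectation mu (fun=> k) = k.
Proof. by move=> [_ mu1]; rewrite /expectation -mulr_suml mu1 mul1r. Qed.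

Lemma next_law_distribution P mu :
  is_transition P -> is_distribution mu -> is_distribution (next_law P mu).
Proof.
move=> trP mud; split=> [y|].
  by apply: sumr_ge0 => x _; rewrite mulr_ge0 ?(mud.1) ?(trP x).1.
rewrite exchange_big /= -[RHS](mud.2); apply: eq_bigr => x _.
by rewrite -mulr_sumr (trP x).2 mulr1.
Qed.

Lemma expectation_point z f :
  expectation (fun x => (x == z)%:R) f = f z.
Proof.
rewrite /expectation (bigD1 z) //= eqxx mul1r big1 ?addr0 // => x /negbTE ->.
by rewrite mul0r.
Qed.

Lemma law_after_distribution P t z :
  is_transition P -> is_distribution (law_after P t z).
Proof.
move=> trP; elim: t => [|t IH]; last exact: next_law_distribution.
split=> [x|]; first exact: ler0n.
have := expectation_point z (fun=> 1); rewrite /expectation => E.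
by rewrite -[RHS]E; apply: eq_bigr => x _; rewrite mulr1.
Qed.

Lemma expectation_law_after P t z f :
  expectation (law_after P t z) f = iter t (averaging P) f z.
Proof.
rewrite /law_after; elim: t f => [|t IH] f; first exact: expectation_point.
by rewrite iterS expectation_next_law IH -iterSr.
Qed.

Lemma expectation_stationary P mu t f :
  is_stationary P mu -> expectation mu (iter t (averaging P) f) = expectation mu f.
Proof.
move=> [_ st]; elim: t => [//|t IH].
rewrite iterS -expectation_next_law -IH.
by apply: eq_bigr => x _; rewrite st.
Qed.

Lemma tv_dist_le_d_TV P mu t z : tv_dist (law_after P t z) mu <= d_TV P mu t.
Proof. exact: le_bigmax. Qed.

(** The optimal test function for total variation is the sign of the
    difference; convergence can thus be read off from expectations of functions
    with values in [-1, 1]. *)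
Lemma tv_dist_sign mu nu :
  tv_dist mu nu =
  2^-1 * (expectation mu (fun x => Num.sg (mu x - nu x)) -
          expectation nu (fun x => Num.sg (mu x - nu x))).
Proof.
rewrite /tv_dist /expectation -sumrB; congr (_ * _); apply: eq_bigr => x _.
by rewrite -mulrBl normrEsg mulrC.
Qed.

Lemma tv_dist_ge_event mu nu (A : pred S) :
  is_distribution mu -> is_distribution nu ->
  \sum_(x | A x) mu x - \sum_(x | A x) nu x <= tv_dist mu nu.
Proof.
move=> [_ mu1] [_ nu1].
(* Shifting the indicator by 1/2 leaves the gap unchanged, both masses being 1,
   and brings the absolute value of the test function down to 1/2. *)
have -> : \sum_(x | A x) mu x - \sum_(x | A x) nu x =
          \sum_x (mu x - nu x) * ((A x)%:R - 2^-1).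
  under [RHS]eq_bigr do rewrite mulrBr.
  rewrite sumrB -mulr_suml sumrB mu1 nu1 subrr mul0r subr0 -sumrB big_mkcond /=.
  by apply: eq_bigr => x _; case: (A x); rewrite ?mulr1 ?mulr0.
rewrite /tv_dist mulr_sumr; apply: ler_sum => x _.
apply: (le_trans (ler_norm _)); rewrite normrM mulrC ler_wpM2r //.
by case: (A x); rewrite ler_norml /=; lra.
Qed.

Lemma chebyshev mu f a r (A : pred S) :
  is_distribution mu -> (forall x, A x -> r ^+ 2 <= (f x - a) ^+ 2) ->
  r ^+ 2 * \sum_(x | A x) mu x <= expectation mu (fun x => (f x - a) ^+ 2).
Proof.
move=> [mu0 _] far; rewrite mulr_sumr big_mkcond /=; apply: ler_sum => x _.
case: ifP => [Ax|_]; last by rewrite mulr_ge0 ?sqr_ge0.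
by rewrite mulrC ler_wpM2l ?far.
Qed.

(** The dual form of a contracting coupling.  A sign function is Lipschitz with
    constant 2 because distinct states are at distance at least 1; after t
    averaging steps its oscillation is at most [2 * k ^+ t * D], and integrating
    over the stationary law compares its mean at time t with its stationary
    mean. *)
Lemma d_TV_contraction P mu (dist : S -> S -> R) (k D : R) t :
  is_transition P -> is_stationary P mu ->
  (forall x y, dist x y <= D) -> (forall x y, x != y -> 1 <= dist x y) ->
  (forall x, dist x x = 0) -> 0 <= k ->
  (forall L f, 0 <= L -> (forall x y, `|f x - f y| <= L * dist x y) ->
     forall x y, `|averaging P f x - averaging P f y| <= L * k * dist x y) ->
  d_TV P mu t <= D * k ^+ t.
Proof.
move=> trP stat distD dist1 dist0 k0 contr.
have [z0 _ | S0] := pickP (fun _ : S => true); last first.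
  have mu1 := stat.1.2; rewrite big1 in mu1; last by move=> x; have := S0 x.
  by move/eqP: mu1; rewrite eq_sym oner_eq0.
have D0 : 0 <= D by rewrite -(dist0 z0).
have lipt (f : S -> R) : (forall x y, `|f x - f y| <= 2 * dist x y) ->
    forall x y, `|iter t (averaging P) f x - iter t (averaging P) f y|
      <= 2 * k ^+ t * dist x y.
  move=> lipf; elim: t => [|s IH] x y; first by rewrite expr0 mulr1.
  by rewrite exprSr mulrA; apply: contr IH x y; rewrite mulr_ge0 ?exprn_ge0.
apply: bigmax_le => [|z _]; first by rewrite mulr_ge0 ?exprn_ge0.
rewrite tv_dist_sign; set s := fun x => Num.sg _.
rewrite expectation_law_after -(expectation_stationary t s stat).
have lips x y : `|s x - s y| <= 2 * dist x y.
  have [->|xy] := eqVneq x y; first by rewrite subrr normr0 dist0 mulr0.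
  have s1 u : `|s u| <= 1 by rewrite normr_sg; case: (_ != 0).
  apply: le_trans (ler_normB _ _) _.
  by have := s1 x; have := s1 y; have := dist1 _ _ xy; lra.
suff H : iter t (averaging P) s z - 2 * k ^+ t * D
    <= expectation mu (iter t (averaging P) s) by lra.
rewrite -[leLHS](expectation_cst _ stat.1); apply: ler_expectation stat.1 _ => x.
have := lipt _ lips z x; rewrite ler_norml => /andP[_].
have : 2 * k ^+ t * dist z x <= 2 * k ^+ t * D.
  by rewrite ler_wpM2l ?mulr_ge0 ?exprn_ge0.
by lra.
Qed.

Lemma expectation_square_deviation mu f a :
  is_distribution mu ->
  expectation mu (fun x => (f x - a) ^+ 2) =
  expectation mu (fun x => f x ^+ 2) - 2 * a * expectation mu f + a ^+ 2.
Proof.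
move=> mud; rewrite -(expectation_cst (a ^+ 2) mud) -mulNr -expectationZ.
by rewrite -!expectationD; apply: eq_bigr => x _; congr (_ * _); ring.
Qed.

(** * Wilson's lower bound from an eigenfunction *)

Section SecondMoment.
Variables (P : S -> S -> R) (f : S -> R) (k V : R).
Hypotheses (trP : is_transition P) (eig : forall x, averaging P f x = k * f x).
Hypotheses (k_ge : 2^-1 <= k) (k_lt1 : k < 1).
Hypothesis jump :
  forall x, averaging P (fun y => (f y - f x) ^+ 2) x <= 2 * (1 - k) * V.

Let variance mu := expectation mu (fun x => (f x - expectation mu f) ^+ 2).

Lemma expectation_eigen_next mu :
  expectation (next_law P mu) f = k * expectation mu f.
Proof.
by rewrite expectation_next_law -expectationZ; apply: eq_bigr => x _; rewrite eig.
Qed.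

(** The jump hypothesis expands to an upper bound on the average of [f ^+ 2]
    over one step, because the cross term is known exactly from the eigenvalue
    equation. *)
Lemma expectation_square_next mu : is_distribution mu ->
  expectation (next_law P mu) (fun x => f x ^+ 2) <=
  (2 * k - 1) * expectation mu (fun x => f x ^+ 2) + 2 * (1 - k) * V.
Proof.
move=> mud; rewrite expectation_next_law.
rewrite -(expectation_cst (2 * (1 - k) * V) mud) -expectationZ -expectationD.
apply: ler_expectation mud _ => x.
have := jump x; rewrite {1}/averaging -/(expectation (P x) _).
rewrite expectation_square_deviation // {2}/expectation -/(averaging P f x) eig.
rewrite /averaging -/(expectation (P x) _); lra.
Qed.

Lemma varianceE mu : is_distribution mu ->
  variance mu = expectation mu (fun x => f x ^+ 2) - expectation mu f ^+ 2.
Proof. by move=> mud; rewrite /variance expectation_square_deviation //; ring. Qed.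

(** The squared mean is multiplied by [k ^+ 2], which is at least the factor
    [2 * k - 1] of the second moment: the difference is a square.  [V] is the
    fixed point of the resulting affine recursion, whence the normalization of
    the jump hypothesis. *)
Lemma variance_next mu : is_distribution mu ->
  variance (next_law P mu) <= (2 * k - 1) * variance mu + 2 * (1 - k) * V.
Proof.
move=> mud; have mud' := next_law_distribution trP mud.
rewrite !varianceE // expectation_eigen_next exprMn.
have := expectation_square_next mud.
have : (2 * k - 1) * expectation mu f ^+ 2 <= k ^+ 2 * expectation mu f ^+ 2.
  rewrite ler_wpM2r ?sqr_ge0 // -subr_ge0.
  by have -> : k ^+ 2 - (2 * k - 1) = (k - 1) ^+ 2; [ring | exact: sqr_ge0].
lra.
Qed.

Lemma variance_law_after t z : variance (law_after P t z) <= V.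
Proof.
elim: t => [|t IH].
  have V0 : 0 <= 2 * (1 - k) * V.
    apply: le_trans (jump z); apply: sumr_ge0 => y _.
    by rewrite mulr_ge0 ?sqr_ge0 ?(trP z).1.
  rewrite /variance !expectation_point subrr expr0n /=.
  by rewrite pmulr_rge0 in V0; [exact: V0 | have := k_lt1; lra].
apply: le_trans (variance_next (law_after_distribution t z trP)) _.
have : (2 * k - 1) * variance (law_after P t z) <= (2 * k - 1) * V.
  by rewrite ler_wpM2l //; have := k_ge; lra.
lra.
Qed.

Lemma expectation_eigen_after t z :
  expectation (law_after P t z) f = k ^+ t * f z.
Proof.
elim: t => [|t IH]; first by rewrite expectation_point mul1r.
by rewrite exprS -mulrA -IH -expectation_eigen_next.
Qed.

Section Stationary.
Variable mu : S -> R.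
Hypothesis stat : is_stationary P mu.

Lemma eq_expectation_stationary g :
  expectation (next_law P mu) g = expectation mu g.
Proof. by apply: eq_bigr => x _; rewrite stat.2. Qed.

(** Stationarity gives [E = k * E] with [k < 1]. *)
Lemma expectation_eigen_stationary : expectation mu f = 0.
Proof.
have E := expectation_eigen_next mu; rewrite eq_expectation_stationary in E.
have : (1 - k) * expectation mu f = 0 by lra.
by move/eqP; rewrite mulf_eq0 subr_eq0 gt_eqF //= => /eqP.
Qed.

Lemma square_stationary : expectation mu (fun x => (f x - 0) ^+ 2) <= V.
Proof.
have /= := expectation_square_next stat.1; rewrite eq_expectation_stationary => H.
rewrite (expectation_square_deviation f 0 stat.1) expectation_eigen_stationary.
have : 2 * (1 - k) * expectation mu (fun x => f x ^+ 2) <= 2 * (1 - k) * V by lra.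
by rewrite ler_pM2l //; have := k_lt1; lra.
Qed.

(** With [M := k ^+ t * f z], the event [M / 2 <= f] has stationary probability
    at most [4 * V / M ^+ 2], and its complement has at most the same
    probability under the law at time t. *)
Lemma d_TV_eigen t z : 0 < f z ->
  (k ^+ t * f z) ^+ 2 * (1 - d_TV P mu t) <= 8 * V.
Proof.
move=> fz; set M := k ^+ t * f z.
have k0 : 0 < k by apply: lt_le_trans k_ge; rewrite invr_gt0.
have M0 : 0 < M by rewrite mulr_gt0 ?exprn_gt0.
have lawd := law_after_distribution t z trP.
pose A x := M / 2 <= f x.
have far_mu : (M / 2) ^+ 2 * \sum_(x | A x) mu x <= V.
  apply: le_trans square_stationary; apply: chebyshev stat.1 _ => x Ax.
  by rewrite subr0 ler_sqr // nnegrE; rewrite /A in Ax; lra.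
have far_law : (M / 2) ^+ 2 * \sum_(x | ~~ A x) law_after P t z x <= V.
  apply: le_trans (variance_law_after t z).
  apply: chebyshev lawd _ => x; rewrite /A -ltNge => Ax.
  rewrite expectation_eigen_after -/M -[leRHS]sqrrN ler_sqr ?nnegrE; lra.
have tot := lawd.2; rewrite (bigID A) /= in tot.
have := tv_dist_ge_event A lawd stat.1; have := tv_dist_le_d_TV P mu t z.
set d := d_TV _ _ _; move: tot far_mu far_law; set tv := tv_dist _ _.
set a := \sum_(x | A x) _; set b := \sum_(x | ~~ _) _; set u := \sum_(x | _) _.
move=> tot far_mu far_law tvd atv.
have : M ^+ 2 * (1 - d) <= M ^+ 2 * (b + u) by rewrite ler_wpM2l ?sqr_ge0 //; lra.
lra.
Qed.

End Stationary.
End SecondMoment.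
End FiniteChains.

(** * Counting edges of a regular graph *)

Section EdgeCounting.
Variables (V : finType) (e : rel V).
Hypotheses (e_simple : simple_graph e) (e_regular : regular_graph e).

Lemma card_edges_at v : #|[set A in edges e | v \in A]| = degree e v.
Proof.
have [sym irr] := e_simple.
have -> : [set A in edges e | v \in A] =
          [set [set v; y] | y in [set y | e v y]].
  apply/setP => A; rewrite inE; apply/andP/imsetP.
    case=> /imsetP[[a b]]; rewrite inE /= => ab -> /set2P[]->.
      by exists b; rewrite ?inE.
    by exists a; rewrite ?inE 1?sym // finset.setUC.
  case=> y; rewrite inE => vy ->; split; last by rewrite set21.
  by apply/imsetP; exists (v, y); rewrite ?inE.
rewrite /degree card_in_imset // => y y'; rewrite !inE => vy _ E.
have : y \in [set v; y'] by rewrite -E set22.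
by case/set2P => // yv; rewrite yv irr in vy.
Qed.

Lemma card_edge A : A \in edges e -> #|A| = 2%N.
Proof.
case/imsetP => -[a b]; rewrite inE /= => ab ->; rewrite cards2.
by case: eqVneq => // E; rewrite E e_simple.2 in ab.
Qed.

(** Double counting of the incidences between vertices and edges; regularity
    makes the left-hand side a product. *)
Lemma handshake v : (#|V| * degree e v = 2 * #|edges e|)%N.
Proof.
have -> : (2 * #|edges e| = \sum_(A in edges e) #|A|)%N.
  by rewrite (eq_bigr (fun=> 2%N)) ?sum_nat_const 1?mulnC // => A /card_edge.
have -> : (\sum_(A in edges e) #|A| = \sum_(A in edges e) \sum_w (w \in A))%N.
  by apply: eq_bigr => A _; rewrite -sum1_card big_mkcond.
rewrite exchange_big /= (eq_bigr (fun=> degree e v)) ?sum_nat_const //.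
move=> w _; rewrite (e_regular v w) -card_edges_at -sum1_card -big_mkcondr /=.
by apply: eq_bigl => A; rewrite inE.
Qed.

Lemma card_edges_gt0 x y : e x y -> (0 < #|edges e|)%N.
Proof.
move=> xy; apply/card_gt0P; exists [set x; y].
by apply/imsetP; exists (x, y); rewrite ?inE.
Qed.

(** A uniformly random edge misses each vertex with the same probability
    [1 - 2 / n].  With [g] a disagreement indicator this gives the contraction
    of the Hamming distance, with [g] the centered color it gives the
    eigenfunction. *)
Lemma edge_average_off (R : numFieldType) (g : V -> R) :
  (0 < #|edges e|)%N ->
  #|edges e|%:R^-1 * \sum_(A in edges e) \sum_(v | v \notin A) g v =
  (1 - 2 / #|V|%:R) * \sum_v g v.
Proof.
move=> m0; rewrite (exchange_big_dep predT) //= !mulr_sumr.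
apply: eq_bigr => v _; rewrite sumr_const -[g v *+ _]mulr_natl mulrA; congr (_ * _).
have n0 : (0 < #|V|)%N by apply/card_gt0P; exists v.
have card_off :
    (degree e v + #|[pred A : {set V} | (A \in edges e) && (v \notin A)]|
     = #|edges e|)%N.
  rewrite -card_edges_at -[RHS](cardsID [set A : {set V} | v \in A]).
  by congr addn; apply: eq_card => A; rewrite !inE // andbC.
have hs := handshake v.
have n0' : #|V|%:R != 0 :> R by rewrite pnatr_eq0 -lt0n.
have m0' : #|edges e|%:R != 0 :> R by rewrite pnatr_eq0 -lt0n.
have hsR : #|V|%:R * (degree e v)%:R = 2 * #|edges e|%:R :> R.
  by rewrite -!natrM hs.
have -> : #|[pred A : {set V} | (A \in edges e) && (v \notin A)]|%:R
    = #|edges e|%:R - (degree e v)%:R :> R.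
  by rewrite -card_off natrD addrAC subrr add0r.
rewrite mulrBr mulVf //; congr (_ - _).
apply: (mulfI n0'); rewrite mulrCA hsR.
by field; rewrite n0' m0'.
Qed.

End EdgeCounting.

(** * The edge flipping chain *)

Section EdgeFlippingChain.
Variables (R : realType) (V : finType) (e : rel V) (p : R).
Hypotheses (p_gt0 : 0 < p) (p_lt1 : p < 1).
Hypotheses (e_simple : simple_graph e) (e_regular : regular_graph e).
Hypothesis m_gt0 : (0 < #|edges e|)%N.

Let k : R := 1 - 2 / #|V|%:R.
Let m : R := #|edges e|%:R.

Lemma averaging_edge_flipping (f : coloring V -> R) x :
  averaging (edge_flipping e p) f x =
  m^-1 * \sum_(A in edges e)
           (p * f (recolor x A true) + (1 - p) * f (recolor x A false)).
Proof.
rewrite /averaging /edge_flipping.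
under eq_bigr do rewrite -mulrA mulr_suml.
rewrite -mulr_sumr exchange_big /=; congr (_ * _); apply: eq_bigr => A _.
under eq_bigr do rewrite mulrDl -!mulrA.
by rewrite big_split /= -!mulr_sumr -!/(expectation _ f) !expectation_point.
Qed.

Lemma edge_flipping_transition : is_transition (edge_flipping e p).
Proof.
move=> x; split=> [y|].
  rewrite mulr_ge0 ?invr_ge0 ?ler0n //; apply: sumr_ge0 => A _.
  by rewrite addr_ge0 // mulr_ge0 ?ler0n // ?subr_ge0 ltW.
have <- : averaging (edge_flipping e p) (fun=> 1) x = 1.
  rewrite averaging_edge_flipping (eq_bigr (fun=> 1)) => [|A _]; last by ring.
  by rewrite sumr_const mulVf // pnatr_eq0 -lt0n.
by apply: eq_bigr => y _; rewrite mulr1.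
Qed.

Definition hamming (x y : coloring V) : R := \sum_v (x v != y v)%:R.

(** Recoloring the same edge with the same color in both configurations erases
    the disagreements on that edge. *)
Lemma hamming_recolor x y A b :
  hamming (recolor x A b) (recolor y A b) =
  \sum_(v | v \notin A) (x v != y v)%:R.
Proof.
rewrite /hamming [RHS]big_mkcond; apply: eq_bigr => v _.
by rewrite !ffunE; case: (v \in A); rewrite ?eqxx.
Qed.

Lemma edge_flipping_contraction L (f : coloring V -> R) :
  (forall x y, `|f x - f y| <= L * hamming x y) ->
  forall x y, `|averaging (edge_flipping e p) f x
               - averaging (edge_flipping e p) f y| <= L * k * hamming x y.
Proof.
move=> lip x y; rewrite !averaging_edge_flipping -mulrBr -sumrB.
rewrite -mulrA -(edge_average_off e_simple e_regular) // mulrCA normrM ger0_norm ?invr_ge0 ?ler0n //.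
rewrite ler_wpM2l ?invr_ge0 ?ler0n // mulr_sumr.
apply: le_trans (ler_norm_sum _ _ _) _; apply: ler_sum => A _.
have := lip (recolor x A true) (recolor y A true).
have := lip (recolor x A false) (recolor y A false).
rewrite !hamming_recolor; set B := L * _ => lF lT.
set a := f _ in lT *; set a' := f _ in lT *.
set b := f _ in lF *; set b' := f _ in lF *.
have -> : p * a + (1 - p) * b - (p * a' + (1 - p) * b') =
  p * (a - a') + (1 - p) * (b - b') by ring.
apply: le_trans (ler_normD _ _) _; rewrite !normrM.
have q0 : 0 <= 1 - p by rewrite subr_ge0 ltW.
rewrite (ger0_norm (ltW p_gt0)) (ger0_norm q0).
have : p * `|a - a'| <= p * B by rewrite ler_wpM2l // ltW.
have : (1 - p) * `|b - b'| <= (1 - p) * B by rewrite ler_wpM2l.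
lra.
Qed.

Lemma d_TV_edge_flipping_le pi t : (1 < #|V|)%N ->
  is_stationary (edge_flipping e p) pi ->
  d_TV (edge_flipping e p) pi t <= #|V|%:R * k ^+ t.
Proof.
move=> n_gt1 stat; apply: (@d_TV_contraction _ _ _ _ hamming) => //.
- exact: edge_flipping_transition.
- move=> x y; rewrite /hamming -natr_sum ler_nat -sum1_card; apply: leq_sum => v _.
  exact: leq_b1.
- move=> x y /eqP xy; have [v xyv] : exists v, x v != y v.
    apply/existsP; rewrite -[X in is_true X]negbK negb_exists; apply/negP.
    by move=> /forallP H; apply: xy; apply/ffunP => v; apply/eqP; rewrite -[_ == _]negbK.
  rewrite /hamming (bigD1 v) //= xyv lerDl; apply: sumr_ge0 => w _; exact: ler0n.
- by move=> x; rewrite /hamming big1 // => v _; rewrite eqxx.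
- rewrite /k subr_ge0 ler_pdivrMr ?ltr0n ?(ltn_trans _ n_gt1) // mul1r.
  by rewrite ler_nat.
- by move=> L f _; exact: edge_flipping_contraction.
Qed.

Definition blue_excess (x : coloring V) : R := \sum_v ((x v)%:R - p).

Lemma blue_excess_all_blue : blue_excess [ffun=> true] = #|V|%:R * (1 - p).
Proof.
rewrite /blue_excess (eq_bigr (fun=> 1 - p)) => [|v _]; last by rewrite ffunE.
by rewrite sumr_const mulr_natl.
Qed.

Lemma blue_excess_recolor x A b :
  blue_excess (recolor x A b) =
  \sum_(v | v \notin A) ((x v)%:R - p) + #|A|%:R * (b%:R - p).
Proof.
rewrite /blue_excess (bigID (fun v => v \in A)) /= addrC; congr (_ + _).
  by apply: eq_bigr => v /negbTE vA; rewrite ffunE vA.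
rewrite (eq_bigr (fun=> b%:R - p)) => [|v vA]; last by rewrite ffunE vA.
by rewrite sumr_const mulr_natl.
Qed.

(** The recolored vertices contribute a term proportional to
    [p * (1 - p) + (1 - p) * (0 - p) = 0], so only the missed ones remain. *)
Lemma averaging_blue_excess x :
  averaging (edge_flipping e p) blue_excess x = k * blue_excess x.
Proof.
rewrite averaging_edge_flipping -(edge_average_off e_simple e_regular) //; congr (_ * _).
by apply: eq_bigr => A _; rewrite !blue_excess_recolor /= mulr1n mulr0n; ring.
Qed.

Lemma blue_excess_jump x A b : A \in edges e ->
  (blue_excess (recolor x A b) - blue_excess x) ^+ 2 <= 4.
Proof.
move=> eA; have -> : 4 = 2 ^+ 2 :> R by ring.
rewrite -real_normK ?num_real // ler_sqr ?nnegrE //.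
rewrite /blue_excess -sumrB; apply: le_trans (ler_norm_sum _ _ _) _.
rewrite -(card_edge e_simple eA) -sum1_card natr_sum [leRHS]big_mkcond /=.
apply: ler_sum => v _; rewrite ffunE.
have := p_gt0; have := p_lt1.
by case: (v \in A); case: b; case: (x v);
  rewrite ler_norml /= ?mulr1n ?mulr0n; lra.
Qed.

(** An instance of [d_TV_eigen] with variance bound [V = n]: squared jumps are
    at most 4 and [2 * (1 - k) * n = 4].  Having [n] at least 4 makes [k] at
    least 1/2. *)
Lemma d_TV_edge_flipping_ge pi t : (3 < #|V|)%N ->
  is_stationary (edge_flipping e p) pi ->
  (k ^+ t * (#|V|%:R * (1 - p))) ^+ 2 * (1 - d_TV (edge_flipping e p) pi t)
    <= 8 * #|V|%:R.
Proof.
move=> n_gt3 stat.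
have n0 : 0 < #|V|%:R :> R by rewrite ltr0n (ltn_trans _ n_gt3).
have n4 : 4 <= #|V|%:R :> R by rewrite ler_nat.
have n0' : #|V|%:R != 0 :> R by rewrite gt_eqF.
rewrite -blue_excess_all_blue.
apply: d_TV_eigen => //.
- exact: edge_flipping_transition.
- exact: averaging_blue_excess.
- have : 2 / #|V|%:R <= 2^-1 :> R by rewrite ler_pdivrMr //; lra.
  by rewrite /k; lra.
- by rewrite /k ltrBlDr ltrDl divr_gt0.
- move=> x; have -> : 2 * (1 - k) * #|V|%:R = 4 by rewrite /k; field.
  rewrite averaging_edge_flipping ler_pdivrMl ?ltr0n // /m mulr_natl -sumr_const.
  apply: ler_sum => A eA.
  have := blue_excess_jump x true eA; have := blue_excess_jump x false eA.
  set b := (_ - _) ^+ 2; set a := (_ - _) ^+ 2 => b4 a4.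
  have : p * a <= p * 4 by rewrite ler_wpM2l // ltW.
  have : (1 - p) * b <= (1 - p) * 4 by rewrite ler_wpM2l // subr_ge0 ltW.
  lra.
- by rewrite blue_excess_all_blue mulr_gt0 // subr_gt0.
Qed.

End EdgeFlippingChain.

(** * From powers of the contraction factor to times *)

Section MixingTimeBounds.
Variables (R : realType) (n : nat).

Let k : R := 1 - 2 / n%:R.

Lemma contraction_power_le t (c : R) : (1 < n)%N ->
  2^-1 * n%:R * (ln n%:R + c) <= t%:R -> n%:R * k ^+ t <= expR (- c).
Proof.
move=> n_gt1 ht.
have n0 : 0 < n%:R :> R by rewrite ltr0n (ltn_trans _ n_gt1).
have k0 : 0 <= k.
  by rewrite /k subr_ge0 ler_pdivrMr // mul1r ler_nat.
have kexp : k ^+ t <= expR (- (2 / n%:R)) ^+ t.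
  by rewrite lerXn2r ?nnegrE ?expR_ge0 //; exact: expR_ge1Dx.
have expt : expR (- (2 / n%:R)) ^+ t <= expR (- (ln n%:R + c)) :> R.
  rewrite -expRM_natl ler_expR mulrN lerN2 mulrCA mulrC.
  by move: ht; rewrite -ler_pdivlMl ?mulr_gt0 ?invr_gt0 // invfM invrK; lra.
rewrite (le_trans (ler_wpM2l (ltW n0) (le_trans kexp expt))) //.
by rewrite opprD expRD (expRN (ln _)) lnK ?posrE // mulVKf // gt_eqF.
Qed.

Lemma time_ge_of_power_le t (K : R) : (3 < n)%N ->
  n%:R * k ^+ t ^+ 2 <= K ->
  4^-1 * n%:R * ln n%:R - (4^-1 * K + 2^-1) * n%:R <= t%:R.
Proof.
move=> n_gt3 hK.
have n4 : 4 <= n%:R :> R by rewrite ler_nat.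
have n0 : 0 < n%:R :> R by lra.
have n2 : 0 < n%:R - 2 :> R by lra.
have k0 : 0 < k.
  by rewrite /k subr_gt0 ltr_pdivrMr // mul1r; lra.
(* [1 - 2 / n] is the inverse of [1 + 2 / (n - 2)], whose logarithm is bounded
   above by the tangent line. *)
have lnk : - (2 / (n%:R - 2)) <= ln k.
  have -> : k = (1 + 2 / (n%:R - 2))^-1.
    by rewrite /k; field; rewrite !gt_eqF //; lra.
  rewrite lnV ?posrE ?addr_gt0 ?divr_gt0 // lerN2.
  by apply: le_ln1Dx; apply: (lt_trans (ltrN10 _)); rewrite divr_gt0.
have kt0 : 0 < n%:R * k ^+ t ^+ 2 by rewrite mulr_gt0 ?exprn_gt0.
have K0 : 0 < K by exact: lt_le_trans hK.
have : ln (n%:R * k ^+ t ^+ 2) <= K.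
  by apply: le_trans (ltW (ln_sublinear K0)); rewrite ler_ln ?posrE.
rewrite lnM ?posrE ?exprn_gt0 // -exprM lnXn // => logK.
have : - (2 / (n%:R - 2)) *+ (t * 2) <= ln k *+ (t * 2) by exact: ler_wMn2r.
rewrite -(mulr_natl (- _)) natrM => lnk2.
have : (n%:R - 2) * (ln n%:R - K) <= 4 * t%:R.
  have -> : 4 * t%:R = (n%:R - 2) * (t%:R * 2 * (2 / (n%:R - 2))) :> R.
    by field; rewrite gt_eqF.
  rewrite ler_pM2l //; lra.
(* Replacing [n - 2] by [n] costs [ln n / 2], at most [n / 2]. *)
have := ln_sublinear n0; lra.
Qed.

End MixingTimeBounds.

(** * The mixing time bounds *)

Theorem theorem3p3 (R : realType) (p c : R)
    (hp0 : 0 < p) (hp1 : p < 1) (hc : 0 < c) :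
  exists C : R,
    forall (V : finType) (e : rel V) (pi : coloring V -> R),
      simple_graph e -> connected_graph e -> regular_graph e ->
      (exists x y : V, e x y) ->
      is_stationary (edge_flipping e p) pi ->
      exists t : nat,
        is_mixing_time (edge_flipping e p) pi (expR (- c)) t /\
        4^-1 * #|V|%:R * ln #|V|%:R - C * #|V|%:R <= t%:R /\
        t%:R <= 2^-1 * #|V|%:R * ln #|V|%:R + C * #|V|%:R.
Proof.
have eps1 : 0 < 1 - expR (- c) by rewrite subr_gt0 expR_lt1; lra.
have q2 : 0 < (1 - p) ^+ 2 by rewrite exprn_gt0 // subr_gt0.
(* [K] bounds n k^(2t) when the distance at time t is at most exp(-c). *)
pose K := 8 / ((1 - p) ^+ 2 * (1 - expR (- c))).
have K0 : 0 < K by rewrite /K divr_gt0 // mulr_gt0.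
exists (1 + K + c) => V e pi simple _ regular [x [y exy]] stat.
have m_gt0 := card_edges_gt0 exy.
have n_gt1 : (1 < #|V|)%N.
  apply/card_gt1P; exists x, y; split => //.
  by apply: contraTneq exy => ->; rewrite simple.2.
have n2 : 2 <= #|V|%:R :> R by rewrite ler_nat.
have ln0 : 0 <= ln #|V|%:R :> R by rewrite ln_ge0 // ler1n ltnW.
pose T : R := 2^-1 * #|V|%:R * (ln #|V|%:R + c).
have T0 : 0 <= T by rewrite /T mulr_ge0 // addr_ge0 // ltW.
pose mixed t := d_TV (edge_flipping e p) pi t <= expR (- c).
have mixedT : mixed (Num.truncn T).+1.
  have := d_TV_edge_flipping_le hp0 hp1 simple regular m_gt0.
  move=> /(_ _ (Num.truncn T).+1 n_gt1 stat) /le_trans; apply.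
  by apply: contraction_power_le n_gt1 _; apply/ltW; case/andP: (truncn_itv T0).
have ex_mixed : exists t, mixed t by exists (Num.truncn T).+1.
have [t mixt t_min] := ex_minnP ex_mixed.
exists t; split; [by split=> // s; exact: t_min|split]; last first.
  have : t%:R <= (Num.truncn T).+1%:R :> R by rewrite ler_nat t_min.
  have /andP[+ _] := truncn_itv T0.
  have : 0 <= K * #|V|%:R by rewrite mulr_ge0 // ltW.
  have : 0 <= c * #|V|%:R by rewrite mulr_ge0 // ltW.
  by rewrite -[(Num.truncn T).+1]addn1 natrD /T; lra.
(* For at most three vertices the lower bound is negative. *)
have [n_gt3|n_le3] := ltnP 3 #|V|; last first.
  have n3 : #|V|%:R <= 3 :> R by rewrite ler_nat.
  have ln3 : ln #|V|%:R < #|V|%:R :> R by apply: ln_sublinear; lra.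
  apply: le_trans (ler0n _ t).
  rewrite mulrAC -mulrBl mulr_le0_ge0 //; lra.
have := d_TV_edge_flipping_ge hp0 hp1 simple regular m_gt0 t n_gt3 stat.
have n0 : 0 < #|V|%:R :> R by lra.
set k := 1 - _ => wilson.
have KE : #|V|%:R * k ^+ t ^+ 2 <= K.
  rewrite /K ler_pdivlMr; last exact: mulr_gt0.
  suff : #|V|%:R * (#|V|%:R * k ^+ t ^+ 2 * ((1 - p) ^+ 2 * (1 - expR (- c))))
         <= #|V|%:R * 8 by rewrite ler_pM2l.
  rewrite [leRHS]mulrC; apply: le_trans wilson.
  have -> : #|V|%:R * (#|V|%:R * k ^+ t ^+ 2 * ((1 - p) ^+ 2 * (1 - expR (- c))))
     = (k ^+ t * (#|V|%:R * (1 - p))) ^+ 2 * (1 - expR (- c)) by ring.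
  by rewrite ler_wpM2l ?sqr_ge0 // lerD2l lerN2.
have := time_ge_of_power_le n_gt3 KE.
have : 0 <= K * #|V|%:R by rewrite mulr_ge0 // ltW.
have : 0 <= c * #|V|%:R by rewrite mulr_ge0 // ltW.
lra.
Qed.
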